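(* Let $n$ be a sufficiently large positive integer and let $m$ be an integer with $n^{6}\le m\le n^{C}$ for a fixed constant $C$. Let $f$ be a monotonically increasing concave function such that $M_{\mathsf{SH}}(m_0,n_0)\le f(n_0)$ for all $n_0$ and all $m_0\ge n^{2.5}$. Then \[ M_{\mathbb{Z}\mathsf{H}}(m,n)\le \tau(m)\cdot f(n)+1, \] where $\tau(m)$ denotes the number of positive divisors of $m$.
   Context: For $N\in\mathbb{N}$ write $[N]=\{0,1,\dots,N-1\}$ and $[N]_{\setminus 0}=[N]\setminus\{0\}$. For a positive integer $N$ and real $x$, $\mathfrak{m}_N(x)$ is the unique element of $(x+N\mathbb{Z})\cap[0,N)$. $\mathbb{Z}_N^{\times}$ denotes the set of $k\in[N]$ coprime to $N$. For positive integers $m\ge n$: - $\mathbb{Z}\mathsf{H}_m$ (blocked linear hashing with modulus $m$ into $n$ bins): choose $a$ uniformly at random from $[m]_{\setminus 0}$ and place $x\in[m]$ in bin $\lfloor \mathfrak{m}_m(ax)/(m/n)\rfloor\in[n]$. - $\mathsf{SH}_m$ (smart linear hashing): choose $a$ uniformly at random from $\mathbb{Z}_m^{\times}$ and place $x\in[m]$ in bin $\lfloor \mathfrak{m}_m(ax)/(m/n)\rfloor$. The maxload of a hash function on a set $X$ is the number of elements of $X$ placed in the fullest bin. $M_{\mathbb{Z}\mathsf{H}}(m,X)$ and $M_{\mathsf{SH}}(m,X)$ denote the (random) maxload of $\mathbb{Z}\mathsf{H}_m$, resp. $\mathsf{SH}_m$, on $X\subset[m]$; $M_{\mathbb{Z}\mathsf{H}}(m,n)$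 and $M_{\mathsf{SH}}(m,n)$ denote the maximum of $\mathbb{E}[M_{\mathbb{Z}\mathsf{H}}(m,X)]$, resp. $\mathbb{E}[M_{\mathsf{SH}}(m,X)]$, over all $n$-element sets $X\subset[m]$ (with the number of bins equal to the size parameter $n_0$ in $M_{\mathsf{SH}}(m_0,n_0)$). *)

(* Defs.v *)
From mathcomp Require Import all_boot all_order all_algebra.
From mathcomp Require Import all_classical all_reals all_analysis.

Set Implicit Arguments.
Unset Strict Implicit.
Unset Printing Implicit Defensive.

Import Order.TTheory GRing.Theory Num.Theory.

Local Open Scope ring_scope.

(* [m] is 'I_m.  Here a * x is a natural number, so its representative in
   [0, m) modulo m is a * x %% m; the divisions below are exact rational
   ones, the bin width m / n being in general not an integer. *)
Definition bin (m n a x : nat) : int :=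
  Num.floor ((a * x %% m)%N%:R / (m%:R / n%:R) : rat).

Definition maxload (m n : nat) (a : 'I_m) (X : {set 'I_m}) : nat :=
  (\max_(j < n) #|[set x in X | bin m n a x == Posz j]|)%N.

Definition uniform_expectation (R : realType) (T : finType) (A : {set T})
    (F : T -> R) : R :=
  (\sum_(a in A) F a) / #|A|%:R.

Definition ZH_multipliers (m : nat) : {set 'I_m} := [set a : 'I_m | a != 0%N :> nat].

Definition SH_multipliers (m : nat) : {set 'I_m} := [set a : 'I_m | coprime a m].

(* Largest expected maxload, with n bins, over the n-element subsets of [m].
   For n <= m there are such subsets and the expectations are nonnegative, so
   the default value 0 of the maximum plays no role; for n > m it is junk. *)
Definition max_expected_maxload (R : realType) (m n : nat)
    (multipliers : {set 'I_m}) : R :=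
  \big[Num.max/0]_(X : {set 'I_m} | #|X| == n)
    uniform_expectation multipliers (fun a => (maxload n a X)%:R).

Definition M_ZH (R : realType) (m n : nat) : R :=
  max_expected_maxload R n (ZH_multipliers m).

Definition M_SH (R : realType) (m n : nat) : R :=
  max_expected_maxload R n (SH_multipliers m).

Definition concave_function (R : realType) (D : set R) (f : R -> R) : Prop :=
  convex_function D (fun x => - f x).

Definition tau (m : nat) : nat := size (divisors m).

(* Main.v *)
(** Split the multipliers [a] by [d = gcd(a, m)]: writing [a = d b] and [m = d m'],
    the hash of [x] with multiplier [a] modulo [m] is the hash of [x mod m'] with
    multiplier [b] modulo [m'].  The keys with a given quotient by [m'] have
    distinct residues, so such an [a] has a maxload at most the sum of [d] maxloads
    of smart hashing modulo [m'].  As there are at most [(m - 1) / d] such [a],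
    each [d] with [m' >= n^2.5] contributes at most [f n] to the expectation.  The
    remaining [d] involve fewer than [m / n] multipliers in total, and each
    of those has a maxload at most [n]. *)

Require Import Defs.
From mathcomp Require Import all_boot all_order all_algebra.
From mathcomp Require Import all_classical all_reals all_analysis.
From mathcomp Require Import zify.

Import Order.TTheory GRing.Theory Num.Theory.

Local Open Scope ring_scope.

(** The factor [d] comes out of the residue and out of the bin width, and cancels in their
    quotient. *)
Lemma bin_muln_gcd (d m n b x : nat) : (0 < d)%N ->
  bin (m * d) n (b * d) x = bin m n b (x %% m).
Proof.
move=> d0; rewrite /bin mulnAC -muln_modl modnMmr !natrM.
have dN0 : d%:R != 0 :> rat by rewrite pnatr_eq0 -lt0n.
by rewrite [m%:R * _ / _]mulrAC -mulf_div divff// mulr1.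
Qed.

Lemma maxload_le_card (m n : nat) (a : 'I_m) (X : {set 'I_m}) :
  (maxload n a X <= #|X|)%N.
Proof.
apply/bigmax_leqP => j _; apply/subset_leq_card/fintype.subsetP => x.
by rewrite inE => /andP[].
Qed.

Lemma maxload_subset (m n : nat) (a : 'I_m) (X Y : {set 'I_m}) :
  X \subset Y -> (maxload n a X <= maxload n a Y)%N.
Proof.
move=> XY; apply/bigmax_leqP => j _.
apply: leq_trans (leq_bigmax_cond j isT).
apply/subset_leq_card/fintype.subsetP => x; rewrite !inE => /andP[xX ->].
by rewrite (fintype.subsetP XY).
Qed.

(** Residue slices may have fewer than [n] elements, while [M_SH] ranges over sets of exactly [n];
    they are padded. *)
Lemma subset_of_card_extend (T : finType) (n : nat) (Y : {set T}) :
  (#|Y| <= n <= #|T|)%N -> exists2 Z : {set T}, Y \subset Z & #|Z| = n.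
Proof.
elim: n => [|n IHn] /andP[Yn nT]; first by exists Y => //; apply/eqP; rewrite -leqn0.
have [Yn1|Yn1] := eqVneq #|Y| n.+1; first by exists Y.
have [|Z YZ cZ] := IHn; first by lia.
have : (0 < #|~: Z|)%N by have := cardsC Z; lia.
move=> /card_gt0P[z]; rewrite inE => zZ; exists (z |: Z).
  exact: fintype.subset_trans YZ (finset.subsetU1 _ _).
by rewrite cardsU1 zZ cZ.
Qed.

Definition residue_slice (m k : nat) (q : nat) (X : {set 'I_m}) : {set 'I_k.+1} :=
  [set inord (x %% k.+1) | x : 'I_m in X & (x %/ k.+1 == q)%N].

Lemma card_residue_slice (m k q : nat) (X : {set 'I_m}) :
  (#|residue_slice _ k q X| <= #|X|)%N.
Proof.
apply: leq_trans (leq_imset_card _ _) _.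
by apply/subset_leq_card/fintype.subsetP => x; rewrite inE => /andP[].
Qed.

(** Partition one bin of [a] by the quotient [q] of the key. Reduction modulo [k.+1] is injective on
    each part and lands in the bin of [b] with the same index. *)
Lemma maxload_residue_slices (d k n : nat) (a : 'I_(k.+1 * d))
    (b : 'I_k.+1) (X : {set 'I_(k.+1 * d)}) :
  (0 < d)%N -> a = (b * d)%N :> nat ->
  (maxload n a X <= \sum_(q < d) maxload n b (residue_slice _ k q X))%N.
Proof.
move=> d0 ab; apply/bigmax_leqP => j _.
have quo_lt (x : 'I_(k.+1 * d)) : (x %/ k.+1 < d)%N by rewrite ltn_divLR// [X in (_ < X)%N]mulnC.
rewrite -sum1_card (partition_big (fun x => Ordinal (quo_lt x)) xpredT)//=.
apply: leq_sum => q _; apply: leq_trans (leq_bigmax_cond j isT).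
rewrite sum1_card -[X in (X <= _)%N](@card_in_imset _ _
  (fun x : 'I_(k.+1 * d) => inord (x %% k.+1) : 'I_k.+1)).
  apply/subset_leq_card/fintype.subsetP => y /imsetP[x /andP[]].
  rewrite inE => /andP[xX /eqP xj] /eqP xq ->; rewrite inE; apply/andP; split.
    by apply/imsetP; exists x => //; rewrite inE xX /= -xq.
  by rewrite inordK ?ltn_pmod// -(bin_muln_gcd d)// -ab xj.
move=> x y /andP[_ /eqP xq] /andP[_ /eqP yq] /(congr1 (@nat_of_ord _)).
rewrite !inordK ?ltn_pmod// => xy; apply: val_inj => /=.
rewrite (divn_eq x k.+1) (divn_eq y k.+1) xy.
by congr (_ * _ + _)%N; have /= := congr1 (@nat_of_ord _) (etrans xq (esym yq)).
Qed.

(** The bijection is multiplication by [d]. The condition [b != ord0] matters only for [k = 0],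
    where 0 is coprime to the modulus 1. Taking [F] on [nat] lets both sides share it although their
    index types differ. *)
Lemma sum_multipliers_gcd (V : nmodType) (d k : nat) (F : nat -> V) : (0 < d)%N ->
  \sum_(a in ZH_multipliers (k.+1 * d) | gcdn a (k.+1 * d) == d) F a =
  \sum_(b in SH_multipliers k.+1 | b != ord0) F (b * d)%N.
Proof.
move=> d0.
have h_lt (b : 'I_k.+1) : (b * d < k.+1 * d)%N by rewrite ltn_pmul2r.
pose h b := Ordinal (h_lt b).
rewrite (reindex_onto h (fun a => inord (a %/ d))) /=.
  apply: eq_bigl => b; rewrite !inE /= mulnK// inord_val eqxx andbT.
  have -> : (gcdn (b * d) (k.+1 * d) == d) = coprime b k.+1.
    by rewrite -muln_gcdl -{2}[d]mul1n eqn_pmul2r.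
  by rewrite muln_eq0 negb_or -[d != 0%N]lt0n d0 andbT andbC.
move=> a /andP[_ /eqP ad]; apply: val_inj => /=.
by rewrite inordK ?ltn_divLR// divnK// -[X in (X %| _)%N]ad dvdn_gcdl.
Qed.

Lemma card_ZH_multipliers (m : nat) : (0 < m)%N -> #|ZH_multipliers m| = m.-1.
Proof.
case: m => // m _; rewrite -[X in _ = X.-1]card_ord -(cardsC1 ord0).
by apply: eq_card => a; rewrite !inE.
Qed.

Lemma card_SH_multipliers_neq0 (k : nat) :
  (#|[pred b in SH_multipliers k.+1 | b != ord0]| <= k)%N.
Proof.
rewrite -[X in (_ <= X)%N]/(k.+1.-1) -card_ZH_multipliers//.
by apply/subset_leq_card/fintype.subsetP => b; rewrite !inE => /andP[].
Qed.

Lemma M_SH_ge0 (R : realType) (m n : nat) : 0 <= M_SH R m n.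
Proof. exact: bigmax_ge_id. Qed.

Lemma sum_maxload_le_M_SH (R : realType) (k n : nat) (Y : {set 'I_k.+1}) :
  (0 < k)%N -> (#|Y| <= n <= k.+1)%N ->
  \sum_(b in SH_multipliers k.+1) (maxload n b Y)%:R <=
    #|[pred b in SH_multipliers k.+1 | b != ord0]|%:R * M_SH R k.+1 n.
Proof.
move=> k0 Yn; have [|Z YZ cZ] := @subset_of_card_extend _ n Y; first by rewrite card_ord.
(* As the modulus exceeds 1, zero is not coprime to it. *)
have -> : #|[pred b in SH_multipliers k.+1 | b != ord0]| = #|SH_multipliers k.+1|.
  apply: eq_card => b; rewrite !inE andbC; case: eqP => //= ->.
  by rewrite /coprime gcd0n; case: k k0 {b Y Yn Z YZ cZ}.
have S0 : 0 < #|SH_multipliers k.+1|%:R :> R.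
  rewrite ltr0n; apply/card_gt0P; exists (inord 1).
  by rewrite inE inordK// coprime1n.
rewrite mulrC -ler_pdivrMr//.
apply: (@le_trans _ _ (uniform_expectation (SH_multipliers k.+1)
                         (fun a => (maxload n a Z)%:R))).
  rewrite ler_pM2r ?invr_gt0//; apply: ler_sum => b _.
  by rewrite ler_nat maxload_subset.
by apply: (le_bigmax_cond _ (fun X : {set 'I_k.+1} => uniform_expectation _
   (fun a => (maxload n a X)%:R : R))); rewrite cZ.
Qed.

Lemma sum_gcd_maxload_le (R : realType) (m d k n : nat) (X : {set 'I_m}) :
  m = (k.+1 * d)%N -> (0 < d)%N -> (0 < k)%N -> (#|X| <= n <= k.+1)%N ->
  \sum_(a in ZH_multipliers m | gcdn a m == d) (maxload n a X)%:R <=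
    m.-1%:R * M_SH R k.+1 n.
Proof.
move=> mE d0 k0 /andP[Xn nk]; subst m.
(* The maxload as a function on [nat], with value 0 out of range. *)
pose F (c : nat) : R := oapp (fun a : 'I_(k.+1 * d) => (maxload n a X)%:R) 0 (insub c).
rewrite (eq_bigr (fun a : 'I_(k.+1 * d) => F a)); last by move=> a _; rewrite /F valK.
rewrite sum_multipliers_gcd//.
apply: (@le_trans _ _ (\sum_(b in SH_multipliers k.+1)
   \sum_(q < d) (maxload n b (residue_slice _ k q X))%:R)).
  rewrite big_mkcondr /=; apply: ler_sum => b _.
  case: ifP => _; last by apply: sumr_ge0.
  rewrite /F insubT ?ltn_pmul2r// => bd /=.
  by rewrite -natr_sum ler_nat maxload_residue_slices.
rewrite exchange_big /=.
apply: (@le_trans _ _ (\sum_(q < d)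
  #|[pred b in SH_multipliers k.+1 | b != ord0]|%:R * M_SH R k.+1 n)).
  apply: ler_sum => q _; apply: sum_maxload_le_M_SH => //.
  by rewrite nk andbT (leq_trans (card_residue_slice _ _ _ _)).
rewrite sumr_const card_ord -mulrnAl -mulr_natr -natrM.
apply: ler_wpM2r; first exact: M_SH_ge0.
(* At most [k] multipliers for each of [d] slices, and [k * d <= k.+1 * d - 1] since [d > 0]. *)
by rewrite ler_nat; have := card_SH_multipliers_neq0 k; nia.
Qed.

Lemma sum_gcd_maxload_le_card (m d k n : nat) (X : {set 'I_m}) :
  m = (k.+1 * d)%N -> (0 < d)%N -> (#|X| <= n)%N ->
  (\sum_(a in ZH_multipliers m | gcdn a m == d) maxload n a X <= k * n)%N.
Proof.
move=> mE d0 Xn; subst m.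
apply: (@leq_trans (\sum_(a in ZH_multipliers (k.+1 * d) |
                         gcdn a (k.+1 * d) == d) n)%N).
  by apply: leq_sum => a _; apply: leq_trans (maxload_le_card _ _ _ _) Xn.
have /= -> := @sum_multipliers_gcd nat d k (fun=> n) d0.
by rewrite sum_nat_const leq_mul2r card_SH_multipliers_neq0 orbT.
Qed.

(** The map sending [d] to [m %/ d] is injective on divisors, with values here in [[1, s]]. *)
Lemma count_large_divisors (m s : nat) : (0 < m)%N ->
  (count (fun d => m %/ d <= s) (divisors m) <= s)%N.
Proof.
move=> m0; rewrite -size_filter -(size_map (divn m)) -[X in (_ <= X)%N](size_iota 1).
apply: uniq_leq_size.
  rewrite map_inj_in_uniq ?filter_uniq ?divisors_uniq// => d e.
  rewrite !mem_filter -!dvdn_divisors// => /andP[_ dm] /andP[_ em] de.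
  apply/eqP; rewrite -(@eqn_pmul2l (m %/ d)) ?divn_gt0 ?(dvdn_gt0 m0)//.
    by rewrite divnK// de divnK.
  exact: dvdn_leq.
move=> _ /mapP[d + ->]; rewrite mem_filter -dvdn_divisors// => /andP[ds dm].
by rewrite mem_iota add1n ltnS ds divn_gt0 ?(dvdn_gt0 m0)// dvdn_leq.
Qed.

(** Squaring states [m / d < n^2.5] within [nat]. With [s] the largest integer such that
    [s ^ 2 < n ^ 5], at most [s] terms occur, each at most [(s - 1) * n], and
    [s ^ 2 * n < n ^ 6 <= m]. *)
Lemma sum_large_divisors (m n : nat) : (0 < n)%N -> (n ^ 6 <= m)%N ->
  (\sum_(d <- divisors m | (m %/ d) ^ 2 < n ^ 5) (m %/ d).-1 * n <= m.-1)%N.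
Proof.
move=> n0 nm.
have ex0 : exists t, (t ^ 2 < n ^ 5)%N by exists 0%N; rewrite expn_gt0 n0.
have ub t : (t ^ 2 < n ^ 5)%N -> (t <= n ^ 5)%N by nia.
case: (ex_maxnP ex0 ub) => s sn smax.
apply: (@leq_trans (\sum_(d <- divisors m | (m %/ d <= s)%N) s.-1 * n)%N).
  rewrite big_mkcond [leqRHS]big_mkcond; apply: leq_sum => d _.
  case: ifP => // /smax ds; rewrite ds leq_mul2r; apply/orP; right; lia.
rewrite big_const_seq iter_addn_0.
apply: leq_trans (leq_mul (leqnn _) (count_large_divisors _ _ _)) _.
  by apply: leq_trans nm; rewrite expn_gt0 n0.
by move: nm; rewrite expnS; nia.
Qed.

Lemma powR_5_2_le (R : realType) (n k : nat) :
  (n ^ 5 <= k ^ 2)%N -> n%:R `^ (5 / 2) <= k%:R :> R.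
Proof.
move=> nk; rewrite -(@ler_pXn2r _ 2)// ?nnegrE ?powR_ge0//.
rewrite -powR_mulrn ?powR_ge0// -powRrM divfK ?pnatr_eq0//.
by rewrite powR_mulrn// -!natrX ler_nat.
Qed.

Theorem mainTheorem1 (R : realType) (C : R) :
  exists N : nat, forall n : nat, (0 < n)%N -> (N <= n)%N ->
  forall m : nat, (n ^ 6 <= m)%N -> m%:R <= n%:R `^ C ->
  forall f : R -> R,
    {in `[1, +oo[ &, {homo f : x y / x <= y}} ->
    concave_function `[1, +oo[%classic f ->
    (forall n0 m0 : nat, (0 < n0)%N -> (n0 <= m0)%N ->
       n%:R `^ (5 / 2) <= m0%:R :> R ->
       M_SH R m0 n0 <= f n0%:R) ->
  M_ZH R m n <= (tau m)%:R * f n%:R + 1.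
Proof.
(* With [n >= 2], nonzero multipliers exist, and [m %/ d >= n] forces a modulus above 1. *)
exists 2 => n n0 n2 m nm _ f _ _ Hf.
have n6 : (n <= n ^ 6)%N by rewrite -[X in (X <= _)%N]expn1 leq_pexp2l.
have m1 : (1 < m)%N by lia.
have m0 : (0 < m)%N by lia.
have M0 : 0 < m.-1%:R :> R by rewrite ltr0n; lia.
have fM k : (n ^ 5 <= k ^ 2)%N -> (n <= k)%N -> M_SH R k n <= f n%:R.
  by move=> nk5 nk; apply: Hf => //; exact: powR_5_2_le.
(* Nonnegativity covers the default 0 of the maximum and lets every divisor be charged [f n],
   including those bounded trivially. *)
have f0 : 0 <= f n%:R.
  apply: le_trans (M_SH_ge0 R m n) (fM _ _ _); last by lia.
  apply: (@leq_trans m); last by nia.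
  by apply: leq_trans nm; rewrite leq_pexp2l.
apply: bigmax_le => [|X /eqP Xn]; first by rewrite addr_ge0// mulr_ge0.
rewrite /uniform_expectation card_ZH_multipliers// ler_pdivrMr//.
have -> : \sum_(a in ZH_multipliers m) (maxload n a X)%:R =
    \sum_(d <- divisors m)
      \sum_(a in ZH_multipliers m | gcdn a m == d) (maxload n a X)%:R :> R.
  under [RHS]eq_bigr do rewrite big_mkcondr.
  rewrite exchange_big; apply: eq_bigr => a _ /=.
  rewrite -big_mkcond (big_rem (gcdn a m)) /=; last first.
    by rewrite -dvdn_divisors// dvdn_gcdr.
  rewrite eqxx big_seq_cond big1 ?addr0// => d /andP[+ /eqP ad].
  by rewrite -ad mem_rem_uniqF// divisors_uniq.
rewrite mulrDl mul1r.
(* The first summands add up to the [tau m] term; the conditional ones add up to at most [m.-1],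
   which is the final [+ 1] after normalization. *)
apply: (@le_trans _ _ (\sum_(d <- divisors m) (m.-1%:R * f n%:R +
   if ((m %/ d) ^ 2 < n ^ 5)%N then ((m %/ d).-1 * n)%:R else 0))).
  rewrite big_seq [leRHS]big_seq; apply: ler_sum => d.
  rewrite -dvdn_divisors// => dm; have d0 := dvdn_gt0 m0 dm.
  have k0 : (0 < m %/ d)%N by rewrite divn_gt0// dvdn_leq.
  have mE : m = ((m %/ d).-1.+1 * d)%N by rewrite prednK// divnK.
  case: ltnP => kn.
    rewrite -[leLHS]add0r lerD ?mulr_ge0 ?ler0n//.
    rewrite -natr_sum ler_nat.
    by apply: sum_gcd_maxload_le_card mE d0 _; rewrite Xn.
  have nk : (n <= m %/ d)%N.
    rewrite -leq_sqr; apply: leq_trans kn; exact: leq_pexp2l.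
  rewrite addr0.
  apply: le_trans (@sum_gcd_maxload_le R m d (m %/ d).-1 n X mE d0 _ _) _.
  - by lia.
  - by rewrite Xn leqnn prednK.
  - by rewrite prednK// ler_pM2l// fM.
rewrite big_split /= big_const_seq count_predT iter_addr_0 -[_ *+ size _]mulr_natl.
rewrite [m.-1%:R * _]mulrC mulrA lerD//.
rewrite -big_mkcond -natr_sum ler_nat.
exact: sum_large_divisors.
Qed.
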